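(* Let $D$ be the directed path with vertex set $\{1,2,3\}$ and arcs $1\to2\to3$. A strategy $\mathcal{R}$ for Rei in the semi-restricted $D$-game is optimal if and only if $\Pr(\mathcal{R}(\mathbf{r})=3)=1/2$ for every restriction vector $\mathbf{r}$ with $\{3\}\subsetneq\operatorname{supp}(\mathbf{r})$.
   Context: A digraph $D$ has a finite vertex set $V(D)$ and a set $E(D)$ of ordered pairs of distinct vertices (arcs), with at most one arc between any pair. $N^+(v)=\{u:vu\in E(D)\}$, $N^-(v)=\{u:uv\in E(D)\}$. A restriction vector is a vector $\mathbf{r}$ of nonnegative integers indexed by $V(D)$; $\operatorname{supp}(\mathbf{r})=\{v:\mathbf{r}_v>0\}$; $\delta_v$ is the indicator vector of $v$. Semi-restricted $D$-game with parameter $\mathbf{r}$: Rei and Norman play $\sum_u\mathbf{r}_u$ rounds; in each round both simultaneously choose a vertex, Rei being required to choose each $u$ exactly $\mathbf{r}_u$ times overall, Norman unrestricted. A strategy for Norman is a function $\mathcal{N}$ assigning to each restriction vector a random variable with values in $V(D)$; a strategy for Rei is a function $\mathcal{R}$ assigning to each $\mathbf{r}$ a random variable with values in $\operatorname{supp}(\mathbf{r})$ (choices independent across players and rounds). Norman's score is defined recursively: $0$ if $\mathbf{r}=0$; otherwise with $x=\mathcal{N}(\mathbf{r})$, $y=\mathcal{R}(\mathbf{r})$, Norman gains $+1$ if $y\in N^+(x)$, $-1$ if $y\in N^-(x)$, $0$ otherwise, and play continues from $\mathbf{r}-\delta_y$. $S_D(\mathbf{r};\mathcal{N},\mathcal{R})$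 is the expected score, $S_D(\mathbf{r};\mathcal{R})=\max_{\mathcal{N}}S_D(\mathbf{r};\mathcal{N},\mathcal{R})$, $S_D(\mathbf{r})=\min_{\mathcal{R}}S_D(\mathbf{r};\mathcal{R})$. A strategy $\mathcal{R}$ for Rei is optimal if $S_D(\mathbf{r};\mathcal{R})=S_D(\mathbf{r})$ for every restriction vector $\mathbf{r}$. *)

(* Defs.v *)
From mathcomp Require Import all_boot all_order all_algebra.
From mathcomp Require Import classical_sets reals.

Set Implicit Arguments.
Unset Strict Implicit.
Unset Printing Implicit Defensive.

Import Order.TTheory GRing.Theory Num.Theory.

Local Open Scope ring_scope.

Record digraph (V : finType) := Digraph {
  arc :> rel V;
  arc_irrefl : irreflexive arc;
  arc_asym : forall u v, arc u v -> ~~ arc v u }.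

Definition outN (V : finType) (D : digraph V) (v : V) : {set V} :=
  [set u | D v u].

Definition inN (V : finType) (D : digraph V) (v : V) : {set V} :=
  [set u | D u v].

Definition restriction (V : finType) := {ffun V -> nat}.

Definition supp (V : finType) (r : restriction V) : {set V} :=
  [set v | (0 < r v)%N].

Definition rounds (V : finType) (r : restriction V) : nat := (\sum_u r u)%N.

(* r - delta_y; the subtraction is only truncated when y is outside supp r,
   and Rei never makes such a choice. *)
Definition play (V : finType) (r : restriction V) (y : V) : restriction V :=
  [ffun u => (r u - (u == y))%N].

(* The law of a V-valued random variable. *)
Record law (R : realType) (V : finType) := Law {
  pr :> V -> R;
  pr_ge0 : forall v, 0 <= pr v;
  pr_sum1 : \sum_v pr v = 1 }.

(* Choices are independent across players and rounds, so a strategy enters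
   the expected score only through the laws of the variables it assigns. *)
Definition strategy (R : realType) (V : finType) := restriction V -> law R V.

(* For r = 0 the support is empty and the game is over: the value of a
   strategy there is unconstrained and never used. *)
Definition rei_strategy (R : realType) (V : finType) (rho : strategy R V) :=
  forall r, r != 0 -> forall v, rho r v != 0 -> v \in supp r.

Definition gain (R : realType) (V : finType) (D : digraph V) (x y : V) : R :=
  if y \in outN D x then 1 else if y \in inN D x then -1 else 0.

(* The recursion is on the number n of rounds left; see score0 and scoreS for
   the recursive characterization. *)
Fixpoint score_rounds (R : realType) (V : finType) (D : digraph V)
    (nu rho : strategy R V) (n : nat) (r : restriction V) : R :=
  if n is n'.+1 then
    \sum_x \sum_y nu r x * rho r y *
      (gain R D x y + score_rounds D nu rho n' (play r y))
  else 0.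

(* S_D(r; N, R), with nu for N and rho for R *)
Definition score (R : realType) (V : finType) (D : digraph V)
    (r : restriction V) (nu rho : strategy R V) : R :=
  score_rounds D nu rho (rounds r) r.

(* S_D(r; R): scores are bounded by rounds r in absolute value, and the
   supremum is attained by a pure best response. *)
Definition score_rei (R : realType) (V : finType) (D : digraph V)
    (r : restriction V) (rho : strategy R V) : R :=
  sup [set score D r nu rho | nu in [set: strategy R V]]%classic.

(* S_D(r) *)
Definition game_value (R : realType) (V : finType) (D : digraph V)
    (r : restriction V) : R :=
  inf [set score_rei D r rho | rho in [set rho | @rei_strategy R V rho]]%classic.

Definition optimal (R : realType) (V : finType) (D : digraph V)
    (rho : strategy R V) :=
  forall r, score_rei D r rho = game_value R D r.

(* The path 1 -> 2 -> 3, with vertex k encoded as k - 1 in 'I_3. *)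
Definition path3_rel : rel 'I_3 := fun i j => j == i.+1 :> nat.

Lemma path3_irrefl : irreflexive path3_rel.
Proof. by move=> i; rewrite /path3_rel ltn_eqF. Qed.

Lemma path3_asym u v : path3_rel u v -> ~~ path3_rel v u.
Proof.
rewrite /path3_rel => /eqP ->.
by rewrite ltn_eqF // ltnW.
Qed.

Definition path3 : digraph 'I_3 := Digraph path3_irrefl path3_asym.

Definition vertex3 : 'I_3 := @Ordinal 3 2 isT.

Lemma score0 (R : realType) (V : finType) (D : digraph V)
    (nu rho : strategy R V) : score D 0 nu rho = 0.
Proof. by rewrite /score /rounds big1 // => u _; rewrite ffunE. Qed.

Lemma rounds_play (V : finType) (r : restriction V) (y : V) :
  y \in supp r -> rounds r = (rounds (play r y)).+1.
Proof.
rewrite inE => ry; rewrite /rounds (bigD1 y) //= (bigD1 y (P := xpredT)) //=.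
rewrite ffunE eqxx subn1 -addSn prednK //; congr (_ + _)%N.
by apply: eq_bigr => u /negbTE uy; rewrite ffunE uy subn0.
Qed.

Lemma scoreS (R : realType) (V : finType) (D : digraph V)
    (nu rho : strategy R V) (r : restriction V) :
  rei_strategy rho -> r != 0 ->
  score D r nu rho =
    \sum_x \sum_y nu r x * rho r y *
      (gain R D x y + score D (play r y) nu rho).
Proof.
move=> hrho r0.
have [y0 y0r] : exists y, y \in supp r.
  apply/set0Pn; apply: contra r0 => /eqP sr0; apply/eqP/ffunP => u.
  move/setP/(_ u): sr0; rewrite !inE lt0n ffunE => /negbT.
  by rewrite negbK => /eqP.
rewrite /score {1}(rounds_play y0r) /=.
apply: eq_bigr => x _; apply: eq_bigr => y _.
have [->|ry0] := eqVneq (rho r y) 0; first by rewrite mulr0 !mul0r.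
have yr := hrho r r0 y ry0.
by have := rounds_play yr; rewrite (rounds_play y0r) => -[->].
Qed.

(* Main.v *)
(** Norman's choices do not influence the restriction vector, so against a fixed
strategy of Rei his best response is greedy.  When Rei plays 1, 2, 3 with
probabilities p1, p2, p3, the greedy gain is max(p2, p3 - p1)
= p2 + max(0, 2 p3 - 1), and the terms p2 add up to r_2 whatever Rei does.
Rei thus minimizes the expected total of max(0, 2 p3 - 1), a problem depending
only on m = r_1 + r_2 and c = r_3.  Its value F satisfies F(0, c) = c,
F(m, 0) = 0, and F(m, c) is the minimum over q = p3 of
max(0, 2 q - 1) + q F(m, c - 1) + (1 - q) F(m - 1, c).  Since
0 < F(m - 1, c) - F(m, c - 1) < 2, this minimum is attained exactly at
q = 1/2. *)

Require Import Defs.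
From mathcomp Require Import all_boot all_order all_algebra.
From mathcomp Require Import classical_sets reals.
From mathcomp Require Import ring lra.

Set Implicit Arguments.
Unset Strict Implicit.
Unset Printing Implicit Defensive.

Import Order.TTheory GRing.Theory Num.Theory.

Local Open Scope ring_scope.

(** * Point masses and fair two-point laws *)

Section PureLaw.
Variables (R : realType) (V : finType).

Lemma mix_ge0 (a b v : V) : 0 <= ((v == a)%:R + (v == b)%:R) / 2 :> R.
Proof. by rewrite divr_ge0 ?addr_ge0 ?ler0n. Qed.

Lemma sum_indicator (f : V -> R) (a : V) : \sum_v (v == a)%:R * f v = f a.
Proof.
rewrite (bigD1 a) //= eqxx mul1r big1 ?addr0 // => v /negbTE ->.
by rewrite mul0r.
Qed.

Lemma mix_sum1 (a b : V) : \sum_v ((v == a)%:R + (v == b)%:R) / 2 = 1 :> R.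
Proof.
rewrite -mulr_suml big_split /=.
have E c : \sum_(v : V) (v == c)%:R = 1 :> R.
  by rewrite -[RHS](sum_indicator (fun=> 1) c); apply: eq_bigr => v _; rewrite mulr1.
by rewrite !E; lra.
Qed.

(* [mix a a] is the point mass at [a]. *)
Definition mix (a b : V) : law R V := Law (mix_ge0 a b) (mix_sum1 a b).

Lemma sum_mix_same (f : V -> R) (a : V) : \sum_v mix a a v * f v = f a.
Proof.
rewrite -[RHS](sum_indicator f); apply: eq_bigr => v _ /=.
by congr (_ * _); lra.
Qed.

End PureLaw.

(** * Expected totals along a play and greedy responses, on any digraph *)

Section Total.
Variables (R : realType) (V : finType) (D : digraph V).
Implicit Types (rho nu : strategy R V) (w : restriction V -> R).

(** The expected sum of [w] over the positions met in [n] rounds; Norman is absent because his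
    choices do not affect the positions. *)
Fixpoint total rho w (n : nat) (r : restriction V) : R :=
  if n is n'.+1 then w r + \sum_y rho r y * total rho w n' (play r y) else 0.

Lemma le_total rho w1 w2 : (forall r, w1 r <= w2 r) ->
  forall n r, total rho w1 n r <= total rho w2 n r.
Proof.
move=> le12; elim=> //= n IHn r; apply: lerD => //.
by apply: ler_sum => y _; apply: ler_wpM2l; rewrite ?pr_ge0.
Qed.

Lemma eq_total rho w1 w2 : (forall r, w1 r = w2 r) ->
  forall n r, total rho w1 n r = total rho w2 n r.
Proof.
move=> eq12 n r; apply/eqP.
by rewrite eq_le !le_total // => r'; rewrite eq12.
Qed.

Lemma totalD rho w1 w2 n r :
  total rho (fun r => w1 r + w2 r) n r = total rho w1 n r + total rho w2 n r.
Proof.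
elim: n r => [|n IHn] r /=; first by rewrite addr0.
under eq_bigr do rewrite IHn mulrDr.
by rewrite big_split /= addrACA.
Qed.

Lemma rounds_gt0 (r : restriction V) : r != 0 -> (0 < rounds r)%N.
Proof.
rewrite lt0n; apply: contra; rewrite /rounds sum_nat_eq0 => /forallP r0.
by apply/eqP/ffunP => u; rewrite ffunE; apply/eqP: (r0 u).
Qed.

Lemma rounds_eq0 (r : restriction V) : rounds r = 0%N -> r = 0.
Proof.
by move=> r0; apply/eqP; apply: contraT => /rounds_gt0; rewrite r0.
Qed.

Lemma total_rounds rho w r : rei_strategy rho -> r != 0 ->
  total rho w (rounds r) r =
    w r + \sum_y rho r y * total rho w (rounds (play r y)) (play r y).
Proof.
move=> hrho r0; have := rounds_gt0 r0.
case E: (rounds r) => [//|n] _ /=; congr (_ + _); apply: eq_bigr => y _.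
have [->|ry] := eqVneq (rho r y) 0; first by rewrite !mul0r.
by have := rounds_play (hrho r r0 y ry); rewrite E => -[->].
Qed.

Lemma rounds_ind (P : restriction V -> Prop) : P 0 ->
  (forall r, r != 0 -> (forall y, y \in supp r -> P (play r y)) -> P r) ->
  forall r, P r.
Proof.
move=> P0 PS r; have [n] := ubnP (rounds r); elim: n r => // n IHn r.
rewrite ltnS => le_rn; have [-> //|r0] := eqVneq r 0.
by apply: PS => // y yr; apply: IHn; rewrite -(rounds_play yr).
Qed.

(** Rei must play [v] exactly [r v] times, whatever his strategy. *)
Lemma total_visits rho v r : rei_strategy rho ->
  total rho (fun r => rho r v) (rounds r) r = (r v)%:R.
Proof.
move=> hrho; elim/rounds_ind: r => [|r r0 IHr].
  by rewrite /rounds big1 => [|u _]; rewrite ffunE.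
rewrite total_rounds //.
transitivity (rho r v + \sum_y rho r y * ((r v)%:R - (y == v)%:R)).
  congr (_ + _); apply: eq_bigr => y _.
  have [->|ry] := eqVneq (rho r y) 0; first by rewrite !mul0r.
  (* The subtraction in [play] is not truncated, since [y] lies in the support. *)
  have yr := hrho r r0 y ry; rewrite IHr // ffunE natrB 1?[v == y]eq_sym //.
  by case: eqP yr => // <-; rewrite inE.
under eq_bigr do rewrite mulrBr.
rewrite big_split /= -mulr_suml pr_sum1 mul1r sumrN.
under [X in - X]eq_bigr do rewrite mulrC.
by rewrite sum_indicator addrCA subrr addr0.
Qed.

Definition round_gain rho r x : R := \sum_y rho r y * gain R D x y.

(** The continuation does not depend on Norman's [x], so averaging over [x] leaves it unchanged. *)
Lemma score_total nu rho r :
  score D r nu rho =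
  total rho (fun r => \sum_x nu r x * round_gain rho r x) (rounds r) r.
Proof.
rewrite /score; move: (rounds r) => n; elim: n r => //= n IHn s.
have E x : \sum_y nu s x * rho s y *
      (gain R D x y + score_rounds D nu rho n (play s y)) =
    nu s x * round_gain rho s x + nu s x *
      \sum_y rho s y * score_rounds D nu rho n (play s y).
  rewrite -mulrDr /round_gain -big_split mulr_sumr; apply: eq_bigr => y _ /=.
  by rewrite -mulrA mulrDr.
under eq_bigr do rewrite E.
rewrite big_split /= -mulr_suml pr_sum1 mul1r; congr (_ + _).
by apply: eq_bigr => y _; rewrite IHn.
Qed.

(** A mixed gain is an average of pure gains, so [best] bounds every round; point masses at [best]
    attain all these bounds at once. *)
Lemma score_rei_total rho (best : restriction V -> V) r :
  (forall r x, round_gain rho r x <= round_gain rho r (best r)) ->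
  score_rei D r rho =
  total rho (fun r => round_gain rho r (best r)) (rounds r) r.
Proof.
move=> bestP; set w := fun _ => _; set T := total _ _ _ _.
have ub nu : score D r nu rho <= T.
  rewrite score_total; apply: le_total => s.
  rewrite -[leRHS]mul1r -(pr_sum1 (nu s)) mulr_suml; apply: ler_sum => x _.
  by rewrite ler_wpM2l ?pr_ge0.
have att : score D r (fun s => mix R (best s) (best s)) rho = T.
  by rewrite score_total; apply: eq_total => s; rewrite sum_mix_same.
rewrite /score_rei; apply/eqP; rewrite eq_le; apply/andP; split.
  apply: ge_sup; first by exists T, (fun s => mix R (best s) (best s)).
  by move=> _ [nu _ <-].
apply: ub_le_sup; first by exists T => _ [nu _ <-].
by exists (fun s => mix R (best s) (best s)).
Qed.

End Total.

(** * The function F and its one-step minimization *)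

Section Surplus.
Variable R : realType.

(* The function F of the header: the expected number of 3's still owed when a
fair coin decides between 3 and the m other choices until one kind runs out. *)
Fixpoint surplus (m : nat) : nat -> R :=
  if m is m'.+1 then
    fix row (c : nat) : R :=
      if c is c'.+1 then (row c' + surplus m' c'.+1) / 2 else 0
  else fun c => c%:R.

Lemma surplus0r m : surplus m 0 = 0. Proof. by case: m. Qed.

Lemma surplus0l c : surplus 0 c = c%:R. Proof. by []. Qed.

Lemma surplusSS m c :
  surplus m.+1 c.+1 = (surplus m.+1 c + surplus m c.+1) / 2.
Proof. by []. Qed.

(** Away from the boundary, the recursion makes each difference the average of two neighbouring
    ones; for [m = 0] it is 1. *)
Lemma surplus_incr m c : 0 < surplus m c.+1 - surplus m c <= 1.
Proof.
elim: m c => [|m IHm] c; first by rewrite /= -natr1; apply/andP; split; lra.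
elim: c => [|c /andP[a1 a2]].
  have /andP[] := IHm 0; rewrite surplusSS !surplus0r => b1 b2.
  by apply/andP; split; lra.
have /andP[b1 b2] := IHm c.+1; rewrite !surplusSS in a1 a2 *.
by apply/andP; split; lra.
Qed.

(** Averaging again. The strict upper bound here and the strict lower bound in [surplus_incr] add up
    to the strict bounds 0 and 2 on F(m - 1, c) - F(m, c - 1). *)
Lemma surplus_decr m c : 0 <= surplus m c - surplus m.+1 c < 1.
Proof.
elim: c m => [|c IHc] m; first by rewrite !surplus0r subrr lexx ltr01.
elim: m => [|m /andP[a1 a2]].
  have /andP[b1 b2] := IHc 0; rewrite surplusSS !surplus0l -natr1 in b1 b2 *.
  by apply/andP; split; lra.
have /andP[b1 b2] := IHc m.+1; rewrite !surplusSS in a1 a2 *.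
by apply/andP; split; lra.
Qed.

(** The function of q minimized in the recursion for F, at the counts [m.+1] and [c.+1]. *)
Definition step_cost (m c : nat) (q : R) : R :=
  Num.max 0 (2 * q - 1) + q * surplus m.+1 c + (1 - q) * surplus m c.+1.

(** The cost is piecewise linear with its break at 1/2. Twice its excess over the value there is
    [(2 * q - 1) * (2 - (y - x))] on the right and [(1 - 2 * q) * (y - x)] on the left. *)
Lemma step_cost_ge m c q : surplus m.+1 c.+1 <= step_cost m c q.
Proof.
have /andP[a1 a2] := surplus_incr m c; have /andP[b1 b2] := surplus_decr m c.
rewrite /step_cost surplusSS -subr_ge0.
set x := surplus m.+1 c in b1 b2 *; set y := surplus m c.+1 in a1 a2 *.
have [hq|hq] := leP 0 (2 * q - 1).
  have : 0 <= (2 * q - 1) * (2 - (y - x)) by apply: mulr_ge0; lra.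
  by lra.
have : 0 <= (1 - 2 * q) * (y - x) by apply: mulr_ge0; lra.
by lra.
Qed.

(** In the same products the factor in [y - x] is nonzero, so the other one vanishes. *)
Lemma step_cost_eq m c q : step_cost m c q = surplus m.+1 c.+1 <-> q = 1 / 2.
Proof.
have /andP[a1 a2] := surplus_incr m c; have /andP[b1 b2] := surplus_decr m c.
rewrite /step_cost surplusSS.
set x := surplus m.+1 c in b1 b2 *; set y := surplus m c.+1 in a1 a2 *.
split=> [|->]; case: leP => hq; try lra; move=> E.
  have /eqP : (2 * q - 1) * (2 - (y - x)) = 0 by lra.
  by rewrite mulf_eq0 => /orP[] /eqP ?; lra.
have /eqP : (1 - 2 * q) * (y - x) = 0 by lra.
by rewrite mulf_eq0 => /orP[] /eqP ?; lra.
Qed.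

End Surplus.

(** * The game on the path *)

Section Path3.
Variable R : realType.
Implicit Types (rho : strategy R 'I_3) (r : restriction 'I_3).

Let v1 : 'I_3 := @Ordinal 3 0 isT.
Let v2 : 'I_3 := @Ordinal 3 1 isT.
Let v3 : 'I_3 := vertex3.

Lemma sum_vertices (f : 'I_3 -> R) : \sum_i f i = f v1 + f v2 + f v3.
Proof.
rewrite !big_ord_recl big_ord0 addr0 addrA.
by congr (f _ + f _ + f _); apply: val_inj.
Qed.

Lemma vertexP (P : 'I_3 -> Prop) : P v1 -> P v2 -> P v3 -> forall v, P v.
Proof.
move=> P1 P2 P3 [[|[|[|//]]] lt_v].
- by rewrite (_ : Ordinal _ = v1) //; apply: val_inj.
- by rewrite (_ : Ordinal _ = v2) //; apply: val_inj.
- by rewrite (_ : Ordinal _ = v3) //; apply: val_inj.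
Qed.

Lemma pr_vertices (l : law R 'I_3) : l v1 + l v2 + l v3 = 1.
Proof. by rewrite -sum_vertices pr_sum1. Qed.

Definition excess rho r : R := Num.max 0 (2 * rho r v3 - 1).

(** The gain of [v2] exceeds that of [v1] by [2 * rho r v3 - 1], and [v3] never beats [v1]. *)
Definition greedy rho r : 'I_3 := if 2 * rho r v3 - 1 <= 0 then v1 else v2.

Lemma round_gain_path3 rho r :
  [/\ round_gain path3 rho r v1 = rho r v2,
      round_gain path3 rho r v2 = rho r v3 - rho r v1 &
      round_gain path3 rho r v3 = - rho r v2].
Proof.
rewrite /round_gain !sum_vertices /gain !inE /= /path3_rel /=.
by split; lra.
Qed.

Lemma greedy_gain rho r :
  round_gain path3 rho r (greedy rho r) = rho r v2 + excess rho r.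
Proof.
have [g1 g2 _] := round_gain_path3 rho r; have := pr_vertices (rho r).
by rewrite /greedy /excess; case: leP => hq; rewrite ?g1 ?g2; lra.
Qed.

Lemma greedy_best rho r x :
  round_gain path3 rho r x <= round_gain path3 rho r (greedy rho r).
Proof.
have [g1 g2 g3] := round_gain_path3 rho r; have h := pr_vertices (rho r).
have p2 := pr_ge0 (rho r) v2; rewrite greedy_gain /excess.
by elim/vertexP: x; rewrite ?g1 ?g2 ?g3; case: (leP 0 (2 * rho r v3 - 1)) => hq; lra.
Qed.

Lemma score_rei_path3 rho r : rei_strategy rho ->
  score_rei path3 r rho = (r v2)%:R + total rho (excess rho) (rounds r) r.
Proof.
move=> hrho; rewrite (score_rei_total _ (@greedy_best rho)).
rewrite (eq_total _ (@greedy_gain rho)) (totalD _ (fun r => rho r v2)).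
by rewrite total_visits.
Qed.

(** The game value without its constant summand [r v2]. *)
Definition value r : R := surplus R (r v1 + r v2) (r v3).

Lemma proper_supp r :
  ([set vertex3]%SET \proper supp r) = (0 < r v1 + r v2)%N && (0 < r v3)%N.
Proof.
rewrite properE finset.sub1set inE andbC; congr (_ && _).
apply/subsetPn/idP => [[v]|].
  by elim/vertexP: v; rewrite !inE // => h _; rewrite addn_gt0 h ?orbT.
by rewrite addn_gt0 => /orP[]; [exists v1 | exists v2]; rewrite ?inE.
Qed.

Lemma value_play r :
  [/\ value (play r v1) = surplus R (r v1 - 1 + r v2) (r v3),
      value (play r v2) = surplus R (r v1 + (r v2 - 1)) (r v3) &
      value (play r v3) = surplus R (r v1 + r v2) (r v3 - 1)].
Proof. by split; rewrite /value !ffunE !eqE /= ?subn0. Qed.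

Lemma pr_out rho r v : rei_strategy rho -> r != 0 -> r v = 0%N -> rho r v = 0.
Proof.
move=> hrho r0 rv; apply/eqP; apply: contraT => /(hrho r r0).
by rewrite inE rv.
Qed.

(** The cost of following [rho] for one round and continuing at cost [value]. *)
Definition step rho r : R :=
  excess rho r + \sum_y rho r y * value (play r y).

(** Once the 3's or the other vertices have run out, [rho r v3] is forced to be 0 or 1; otherwise
    the choice of q is free. *)
Variant step_spec rho r : Prop :=
| StepForced of ~~ ([set vertex3]%SET \proper supp r) & step rho r = value r
| StepFree m c of [set vertex3]%SET \proper supp r &
    step rho r = step_cost m c (rho r v3) & value r = surplus R m.+1 c.+1.

Lemma stepP rho r : rei_strategy rho -> r != 0 -> step_spec rho r.
Proof.
move=> hrho r0; have h := pr_vertices (rho r).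
have out v := @pr_out rho r v hrho r0.
have [e1 e2 e3] := value_play r.
case E3: (r v3) => [|c].
  apply: StepForced; first by rewrite proper_supp E3 andbF.
  rewrite /step sum_vertices /excess e1 e2 e3 (out v3 E3) /value E3 !surplus0r.
  by case: leP => h0; lra.
case Em: (r v1 + r v2)%N => [|m].
  apply: StepForced; first by rewrite proper_supp Em.
  move/eqP: (Em); rewrite addn_eq0 => /andP[/eqP z1 /eqP z2].
  have h3 : rho r v3 = 1 by rewrite -h (out v1 z1) (out v2 z2) !add0r.
  rewrite /step sum_vertices /excess e3 (out v1 z1) (out v2 z2) h3 /value Em E3.
  by rewrite /= subn1 /= -natr1; case: leP => h0; lra.
apply: (@StepFree _ _ m c); rewrite ?proper_supp /value ?Em ?E3 //.
(* If [r v1 = 0], the truncated subtraction gives the wrong index, but the probability in front is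
   0. *)
have t1 : rho r v1 * surplus R (r v1 - 1 + r v2) c.+1 =
          rho r v1 * surplus R m c.+1.
  case E: (r v1) => [|k]; first by rewrite (out v1 E) !mul0r.
  by move: Em; rewrite E subn1 => -[->].
have t2 : rho r v2 * surplus R (r v1 + (r v2 - 1)) c.+1 =
          rho r v2 * surplus R m c.+1.
  case E: (r v2) => [|k]; first by rewrite (out v2 E) !mul0r.
  by move: Em; rewrite E subn1 addnS => -[->].
rewrite /step sum_vertices e1 e2 e3 E3 Em t1 t2 subSS subn0 /step_cost /excess.
have -> : 1 - rho r v3 = rho r v1 + rho r v2 by lra.
by ring.
Qed.

Lemma step_ge rho r : rei_strategy rho -> r != 0 -> value r <= step rho r.
Proof.
by move=> hrho /(stepP hrho)[_ ->|m c _ -> ->] //; apply: step_cost_ge.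
Qed.

Definition halving rho : Prop := forall r,
  [set vertex3]%SET \proper supp r -> rho r vertex3 = 1 / 2.

Lemma step_eq rho r : rei_strategy rho -> r != 0 ->
  step rho r = value r <->
  ([set vertex3]%SET \proper supp r -> rho r vertex3 = 1 / 2).
Proof.
move=> hrho /(stepP hrho)[/negbTE -> -> //|m c -> -> ->].
by rewrite step_cost_eq; split=> // ->.
Qed.

Lemma value0 : value 0 = 0. Proof. by rewrite /value !ffunE. Qed.

Lemma total_ge_value rho r : rei_strategy rho ->
  value r <= total rho (excess rho) (rounds r) r.
Proof.
move=> hrho; elim/rounds_ind: r => [|r r0 IHr].
  by rewrite value0 /rounds big1 // => u _; rewrite ffunE.
rewrite total_rounds //; apply: le_trans (step_ge hrho r0) _.
rewrite lerD2l; apply: ler_sum => y _.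
have [->|ry] := eqVneq (rho r y) 0; first by rewrite !mul0r.
by rewrite ler_wpM2l ?pr_ge0 // IHr // (hrho r r0 y ry).
Qed.

(** Equality at every position, reached or not, lets [value] replace the totals after one move, so
    each [step] is minimal; the converse is by induction on rounds. *)
Lemma total_eq_value rho : rei_strategy rho ->
  (forall r, total rho (excess rho) (rounds r) r = value r) <-> halving rho.
Proof.
move=> hrho; split=> [E r pr3|half r].
  have r0 : r != 0.
    by apply: contraTneq pr3 => ->; rewrite proper_supp !ffunE.
  apply: (step_eq hrho r0).1 pr3; rewrite -[RHS]E total_rounds //.
  by congr (_ + _); apply: eq_bigr => y _; rewrite E.
elim/rounds_ind: r => [|r r0 IHr].
  by rewrite value0 /rounds big1 // => u _; rewrite ffunE.
rewrite total_rounds // -(step_eq hrho r0).2 //; last exact: half.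
congr (_ + _); apply: eq_bigr => y _.
have [->|ry] := eqVneq (rho r y) 0; first by rewrite !mul0r.
by rewrite IHr // (hrho r r0 y ry).
Qed.

(** * A halving strategy and the value of the game *)

Definition fair_other r : 'I_3 :=
  if (0 < r v1)%N then v1 else if (0 < r v2)%N then v2 else v3.

(** When only one kind of vertex remains, both arguments of [mix] coincide and the law is a point
    mass in the support. *)
Definition fair_strategy : strategy R 'I_3 := fun r =>
  mix R (fair_other r) (if (0 < r v3)%N then v3 else fair_other r).

Lemma fair_other_supp r : r != 0 -> fair_other r \in supp r.
Proof.
move=> r0; rewrite /fair_other; case: ifP => [|n1]; first by rewrite inE.
case: ifP => [|n2]; first by rewrite inE.
rewrite inE lt0n; apply: contra r0 => /eqP n3; apply/eqP/ffunP => u.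
rewrite ffunE; elim/vertexP: u => //; apply/eqP.
  by rewrite -leqn0 leqNgt n1.
by rewrite -leqn0 leqNgt n2.
Qed.

Lemma fair_strategy_rei : rei_strategy fair_strategy.
Proof.
move=> r r0 v; apply: contraR => nv; rewrite /fair_strategy /=.
have -> : (v == fair_other r) = false.
  by apply: contraNF nv => /eqP ->; apply: fair_other_supp.
have -> : (v == (if (0 < r v3)%N then v3 else fair_other r)) = false.
  apply: contraNF nv => /eqP ->; case: ifP => [|_]; first by rewrite inE.
  exact: fair_other_supp.
by rewrite addr0 mul0r.
Qed.

Lemma fair_strategy_halving : halving fair_strategy.
Proof.
move=> r; rewrite proper_supp => /andP[m0 c0].
have : (v3 == fair_other r) = false.
  rewrite /fair_other; case: ifP => // n1; case: ifP => // n2.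
  by move: m0; rewrite addn_gt0 n1 n2.
rewrite /fair_strategy c0 => /= ->.
by rewrite add0r.
Qed.

(** [total_ge_value] bounds the infimum below, and [fair_strategy] attains the bound. *)
Lemma game_value_path3 r : game_value R path3 r = (r v2)%:R + value r.
Proof.
have lb : lbound [set score_rei path3 r rho |
    rho in [set rho | @rei_strategy R 'I_3 rho]]%classic ((r v2)%:R + value r).
  by move=> _ [rho hrho <-]; rewrite score_rei_path3 // lerD2l total_ge_value.
have at_fair : score_rei path3 r fair_strategy = (r v2)%:R + value r.
  rewrite score_rei_path3; last exact: fair_strategy_rei.
  by rewrite (total_eq_value fair_strategy_rei).2 //; apply: fair_strategy_halving.
rewrite /game_value; apply/eqP; rewrite eq_le; apply/andP; split.
  rewrite -at_fair; apply: ge_inf; first by exists ((r v2)%:R + value r).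
  by exists fair_strategy => //; apply: fair_strategy_rei.
apply: lb_le_inf => //; exists ((r v2)%:R + value r), fair_strategy => //.
exact: fair_strategy_rei.
Qed.

End Path3.

Theorem theorem2p4 (R : realType) (rho : strategy R 'I_3)
    (hrho : rei_strategy rho) :
  optimal path3 rho <->
  (forall r : restriction 'I_3,
     [set vertex3]%SET \proper supp r -> rho r vertex3 = 1 / 2).
Proof.
rewrite -/(halving rho) -(total_eq_value hrho).
(* The summand [r v2] is common to the score and the game value, so it cancels. *)
split=> E r; last by rewrite score_rei_path3 // game_value_path3 E.
by have := E r; rewrite score_rei_path3 // game_value_path3 => /addrI.
Qed.
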